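(* Let $n\geq 2$ and let $A=\mathrm{diag}(d_1,d_2,\dots,d_n)$ be an $n\times n$ diagonal matrix with $d_1,\dots,d_n\in\mathbb Z$ and $|d_i|>1$ for $1\le i\le n$. Fix $q\in\mathbb N$ (a positive integer), $1\le j\le n-1$ and $a_j\in\mathbb Z$, and let $X=X(q,0,\dots,0,a_j,0,\dots,0)$ (with $a_j$ as the $j$-th twist parameter). Then there exists a $C(\mathbb T^n)$-module monomorphism $\mathcal R: X\to\Xi\subseteq L^2(\mathbb R^n)$ such that: 1. $\langle \mathcal R(h_1),\mathcal R(h_2)\rangle_{C(\mathbb T^n)}=\langle h_1,h_2\rangle_{C(\mathbb T^n)}$ for all $h_1,h_2\in X$; and 2. $\mathcal R(X)\subseteq D(\mathcal R(X))$, where $D$ is the conjugate by the Fourier transform of the dilation operator with respect to $A$.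
   Context: Write $e(r)=e^{2\pi i r}$. Functions in $C(\mathbb T^n)$ are identified with continuous $\mathbb Z^n$-periodic functions on $\mathbb R^n$. $\Xi$ is the right Hilbert $C(\mathbb T^n)$-module obtained by completing $C_c(\mathbb R^n)$ with respect to the norm $\|\xi\|=\|\langle\xi,\xi\rangle_{C(\mathbb T^n)}\|_\infty^{1/2}$ determined by $\langle \xi,\eta\rangle_{C(\mathbb T^n)}(t)=\sum_{p\in\mathbb Z^n}(\overline{\xi}\eta)(t-p)$, with $C(\mathbb T^n)$ acting by pointwise multiplication; its elements are continuous functions on $\mathbb R^n$ and $\Xi\subseteq L^2(\mathbb R^n)$. $X(q,0,\dots,0,a_j,0,\dots,0)$ is the right $C(\mathbb T^n)$-module of all continuous $f:\mathbb R^n\to\mathbb C$ in variables $(s_1,\dots,s_{n-1},t)$ that are $1$-periodic in each of $s_1,\dots,s_{n-1}$ and satisfy $$f(s_1,\dots,s_{n-1},t-kq)=e(ka_js_j)f(s_1,\dots,s_{n-1},t),\qquad k\in\mathbb Z,$$ with $C(\mathbb T^n)$ acting by pointwise multiplication and inner product $$\langle h_1,h_2\rangle_{C(\mathbb T^n)}(s_1,\dots,s_{n-1},t)=\sum_{k=0}^{q-1}\overline{h_1(s_1,\dots,s_{n-1},t-k)}\,h_2(s_1,\dots,s_{n-1},t-k).$$ For an invertible matrix $A$, $D_A(\zeta)(x)=|\det A|^{1/2}\zeta(Ax)$ on $L^2(\mathbb R^n)$, and $D=\mathcal F D_A\mathcal F^{*}$ with $\mathcal F$ the Fourier transform $\mathcal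 F(f)(x)=\int_{\mathbb R^n}f(t)e(-t\cdot x)\,dt$; explicitly $(D\xi)(x)=|\det A|^{-1/2}\xi((A^t)^{-1}x)$. *)

(* Defs.v *)
From mathcomp Require Import all_boot all_order all_algebra.
From mathcomp Require Import finmap complex.
From mathcomp Require Import all_classical all_reals all_analysis.
From mathcomp.analysis.showcase Require summability.

Set Implicit Arguments.
Unset Strict Implicit.
Unset Printing Implicit Defensive.

Import Order.TTheory GRing.Theory Num.Theory.
Import numFieldNormedType.Exports.

Local Open Scope classical_set_scope.
Local Open Scope ring_scope.

(* R[i] seen as a numClosedFieldType, so that it gets the topology of its norm:
   the bare R[i] is not recognized as a topological type. *)
Definition Cplx (R : realType) : numClosedFieldType := R[i].

Section Modules.
Variables (R : realType) (n : nat).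

(* R^n as row vectors, with coordinates (s_1, ..., s_{n-1}, t) of x being
   x 0 i for i = 0, ..., n-1; so x 0 i is one of the s's iff i.+1 < n. *)
Local Notation V := 'rV[R]_n.
Local Notation C := (Cplx R).

Definition e (r : R) : C := (cos (2 * pi * r) +i* sin (2 * pi * r))%C.

Definition CT : set (V -> C) :=
  [set c | continuous c /\
     forall (p : 'rV[int]_n) (x : V), c (x + map_mx intr p) = c x].

Definition CT_monomorphism (M N : set (V -> C)) (F : (V -> C) -> (V -> C)) :=
  [/\ forall f, M f -> N (F f),
      forall f g, M f -> M g -> F (f \+ g) = F f \+ F g,
      forall f c, M f -> CT c -> F (f \* c) = F f \* c &
      set_inj M F].

Definition Cc : set (V -> C) :=
  [set f | continuous f /\ compact (closure [set x | f x != 0])].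

(* summability.sum is the limit of the finite partial sums along the directed
   family of finite subsets of Z^n *)
Definition Xi_inner (f g : V -> C) (t : V) : C :=
  summability.sum (fun p : 'rV[int]_n =>
    (f (t - map_mx intr p))^* * g (t - map_mx intr p)).

Definition Xi_norm (f : V -> C) : R :=
  Num.sqrt (sup (range (fun t : V => Normc.normc (Xi_inner f f t)))).

(* The completion of Cc, realized by functions: since |f x| <= Xi_norm f on Cc,
   a Cauchy sequence of Cc converges uniformly, and it is null for Xi_norm
   iff its limit is 0; so its class is identified with its pointwise limit.
   Xi_norm is only evaluated on Cc, where the sums are finite and the sup is
   that of a bounded set. *)
Definition Xi : set (V -> C) :=
  [set f | exists u : nat -> V -> C,
     [/\ forall k, Cc (u k),
         forall eps : R, 0 < eps -> exists N, forall k l,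
           (N <= k)%N -> (N <= l)%N -> Xi_norm (u k \- u l) < eps &
         forall x, u k x @[k --> \oo] --> f x]].

Definition tvec : V := \row_i (i.+1 == n)%:R.

Definition X (q : nat) (j : 'I_n) (a : int) : set (V -> C) :=
  [set f | [/\ continuous f,
      forall (i : 'I_n) (x : V), (i.+1 < n)%N -> f (x + delta_mx 0 i) = f x &
      forall (k : int) (x : V),
        f (x - (k%:~R * q%:R) *: tvec) = e (k%:~R * a%:~R * x 0 j) * f x]].

Definition X_inner (q : nat) (f g : V -> C) (x : V) : C :=
  \sum_(k < q) (f (x - k%:R *: tvec))^* * g (x - k%:R *: tvec).

(* The operator D = F D_A F^* : (D f)(x) = |det A|^(-1/2) f((A^t)^-1 x);
   on row vectors, (A^t)^-1 x reads x *m A^-1. *)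
Definition dilation_hat (A : 'M[R]_n) (f : V -> C) (x : V) : C :=
  ((Num.sqrt `|\det A|)^-1)%:C%C * f (x *m invmx A).

End Modules.

(* Main.v *)
Require Import Defs.
From mathcomp Require Import all_boot all_order all_algebra.
From mathcomp Require Import finmap complex.
From mathcomp Require Import all_classical all_reals all_analysis.
From mathcomp.analysis.showcase Require summability.
From mathcomp Require Import ring lra zify.
Import Order.TTheory GRing.Theory Num.Theory.
Import numFieldNormedType.Exports.
Local Open Scope classical_set_scope.
Local Open Scope ring_scope.

(* Multiplication by a compactly supported continuous window w >= 0 maps X into
   C_c(R^n) and is isometric as soon as the translates of w^2 by the lattice
   Gamma = Z^(n-1) x qZ sum to 1.  Take for w a product of Meyer-type bumps:
   with c_i the period of Gamma along the i-th axis, w = 1 where all |x_i| <= c_i/3,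
   and w != 0 exactly where all |x_i| < 2c_i/3.  For h in X, the function
   F(y) = |det A|^(1/2) w(Ay) h(Ay) lives where w = 1, since |d_i| >= 2.  Hence its
   twisted Gamma-periodization g lies in X and satisfies w g = F, i.e.
   D(w g) = w h; the twist of h itself plays no role. *)

Set Implicit Arguments.
Unset Strict Implicit.
Unset Printing Implicit Defensive.

(** * Finitely supported sums and the character [e] *)

Lemma sum_finite_support (I : choiceType) (T : finType) {K : numFieldType}
    {V : normedModType K} (F : I -> V) (f : T -> I) :
  injective f -> (forall p, F p != 0 -> exists c, p = f c) ->
  summability.sum F = \sum_c F (f c).
Proof.
move=> finj Fsupp; have totF := @summability.totally_filter I.
apply: norm_cvg_lim; apply: cvg_near_cst.
(* The net of partial sums is eventually constant: any finite [J] containing the image of [f] gives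
   the full sum. *)
exists [fset f c | c in T]%fset => //= J SJ.
rewrite /summability.partial_sum -(big_seq_fsetE _ J xpredT F) /=.
rewrite -(big_fset_incl _ SJ); last first.
  move=> p _ pS; apply: contraNeq pS => /Fsupp[c ->].
  by apply/imfsetP; exists c.
rewrite big_imfset /=; last by move=> c1 c2 _ _ /finj.
by rewrite big_enum.
Qed.

Lemma continuous_real_complex (R : realType) :
  continuous (fun x : R => x%:C%C : Cplx R).
Proof.
move=> x; apply/cvgrPdist_lt => eps eps0.
(* A positive element of the complex field is real, so the estimate reduces to one in [R]. *)
have [r0 epsE] : 0 < complex.Re eps /\ eps = (complex.Re eps)%:C%C.
  move: eps eps0 => [a b]; rewrite ltcE /= => /andP[/eqP -> a0]; by split.
rewrite epsE; near=> t.
rewrite -rmorphB normc_def /= expr0n addr0 sqrtr_sqr ltcR.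
near: t; by apply: cvgr_dist_lt.
Unshelve. all: by end_near. Qed.

Lemma continuous_e (R : realType) : continuous (@e R).
Proof.
move=> r.
have -> : @e R = fun r => (cos (2 * pi * r))%:C%C + 'i%C * (sin (2 * pi * r))%:C%C.
  by apply/funext => x; rewrite /e [LHS]complexE.
have lin : continuous (fun r : R => 2 * pi * r) by apply: mulrl_continuous.
apply: cvgD.
  apply: (@continuous_comp _ _ _ (fun r => cos (2 * pi * r))
    (fun x => x%:C%C : Cplx R)).
    apply: continuous_comp; [exact: lin|exact: continuous_cos].
  exact: continuous_real_complex.
apply: cvgM; first exact: cvg_cst.
apply: (@continuous_comp _ _ _ (fun r => sin (2 * pi * r)) (fun x => x%:C%C : Cplx R)).
  apply: continuous_comp; [exact: lin|exact: continuous_sin].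
exact: continuous_real_complex.
Qed.

Lemma eD (R : realType) (x y : R) : e (x + y) = e x * e y.
Proof.
rewrite /e mulrDr cosD sinD.
by apply/eqP; rewrite eq_complex /= eqxx /= addrC.
Qed.

Lemma e_int (R : realType) (m : int) : e (m%:~R : R) = 1.
Proof.
have en k : e (k%:R : R) = 1.
  elim: k => [|k IH]; first by rewrite /e mulr0 cos0 sin0.
  rewrite -addn1 natrD eD IH mul1r /e mulr1 mulr_natl cos2pi sin2pi //.
case: m => k; first exact: en.
rewrite NegzE mulrNz.
by rewrite -[LHS]mulr1 -{1}(en k.+1) -eD addNr -[0]/(0%:R) en.
Qed.

Lemma e_conj_mul (R : realType) (x : R) : (e x)^* * e x = 1.
Proof.
rewrite /e; apply/eqP; rewrite eq_complex /=.
have := cos2Dsin2 (2 * pi * x).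
set c := cos _; set s := sin _ => cs.
apply/andP; split; apply/eqP; last by ring.
by rewrite mulNr opprK -!expr2.
Qed.

(** * One-dimensional bump and rounding to the nearest integer *)

Section Bump.
Variable R : realType.

(** The square root is there because the squares must sum to 1: the square is a trapezoid with ramps
    between 1/3 and 2/3. *)
Definition bump (u : R) : R := Num.sqrt (Num.max 0 (Num.min 1 (2 - 3 * `|u|))).

Lemma bump_neq0 u : (bump u != 0) = (`|u| < 2 / 3).
Proof.
rewrite sqrtr_eq0 -ltNge lt_max ltxx lt_min ltr01 subr_gt0 /=.
by apply/idP/idP => ?; lra.
Qed.

Lemma bump_eq1 u : `|u| <= 1 / 3 -> bump u = 1.
Proof.
by rewrite /bump => hu; rewrite min_l ?max_r ?ler01 ?sqrtr1 //; lra.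
Qed.

(** With [v = 2 - 3 * u], the two squares are the truncations of [v] and [1 - v] to [0, 1], and
    truncation commutes with [v -> 1 - v]. *)
Lemma bump_partition u : 0 <= u < 1 -> bump u ^+ 2 + bump (u - 1) ^+ 2 = 1.
Proof.
move=> /andP[u0 u1]; rewrite /bump !sqr_sqrtr ?le_max ?lexx //.
rewrite (ger0_norm u0) ler0_norm; last lra.
set v := 2 - 3 * u; have -> : 2 - 3 * - (u - 1) = 1 - v by rewrite /v; ring.
have m1 : 1 <= v \/ v <= 1 by case/orP: (le_total 1 v); [left|right].
have m0 : 0 <= v \/ v <= 0 by case/orP: (le_total 0 v); [left|right].
case: m1 => v1.
  rewrite (min_l v1) (max_r (@ler01 R)) (min_r (_ : 1 - v <= 1))
    ?(max_l (_ : 1 - v <= 0)); lra.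
rewrite (min_r v1); case: m0 => v0.
  rewrite (max_r v0) (min_r (_ : 1 - v <= 1)) ?(max_r (_ : 0 <= 1 - v)); lra.
rewrite (max_l v0) (min_l (_ : 1 <= 1 - v)) ?(max_r (@ler01 R)); lra.
Qed.

(** The support has radius 2/3 < 1, which leaves only the floor of [u] and its successor. The
    boolean encoding makes the relevant translates a finite type. *)
Lemma bump_sub_int_neq0 u (l : int) :
  bump (u - l%:~R) != 0 -> exists b : bool, l = Num.floor u + (b : nat).
Proof.
rewrite bump_neq0 ltr_norml => /andP[h1 h2].
have /andP[f1 f2] := floor_itv u; rewrite intrD in f2.
have : Num.floor u - 1 < l by rewrite -(ltr_int R) intrB; lra.
have : l < Num.floor u + 2 by rewrite -(ltr_int R) intrD; lra.
move=> a b; have [->|->] : l = Num.floor u \/ l = Num.floor u + 1 by lia.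
  by exists false; rewrite addr0.
by exists true.
Qed.

Lemma continuous_bump : continuous bump.
Proof.
move=> u; apply: (@continuous_comp _ _ _
  (fun u : R => Num.max 0 (Num.min 1 (2 - 3 * `|u|)))); last first.
  exact: sqrt_continuous.
apply: continuous_max; first exact: cvg_cst.
apply: continuous_min; first exact: cvg_cst.
apply: cvgB; first exact: cvg_cst.
apply: cvgM; first exact: cvg_cst.
exact: norm_continuous.
Qed.

(** Ties always round up, so that rounding commutes with integer translations without exception. *)
Definition nearest (u : R) : int := Num.floor (u + 1 / 2).

Lemma nearest_dist u : `|u - (nearest u)%:~R| <= 1 / 2.
Proof.
have /andP[f1 f2] := floor_itv (u + 1 / 2); rewrite intrD in f2.
by rewrite /nearest ler_norml; apply/andP; split; lra.
Qed.

Lemma nearestD u (m : int) : nearest (u + m%:~R) = nearest u + m.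
Proof. by rewrite /nearest addrAC floorDrz ?intrKfloor. Qed.

Lemma nearest_neq_dist u (l : int) : l != nearest u -> 1 / 2 <= `|u - l%:~R|.
Proof.
have /andP[f1 f2] := floor_itv (u + 1 / 2); rewrite intrD in f2.
rewrite -/(nearest u) in f1 f2 *.
rewrite neq_lt => /orP[] h.
  have : l + 1 <= nearest u by lia.
  rewrite -(ler_int R) intrD => ?; rewrite ger0_norm; lra.
have : nearest u + 1 <= l by lia.
rewrite -(ler_int R) intrD => ?; rewrite ler0_norm; lra.
Qed.

End Bump.

(** * The lattice Gamma, the window, and translations of elements of [X] *)

Section Lattice.
Variables (R : realType) (n q : nat).
Hypothesis q_gt0 : (0 < q)%N.

Definition period (i : 'I_n) : nat := if i.+1 == n then q else 1.

Definition lattice_pt (l : 'rV[int]_n) : 'rV[R]_n :=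
  \row_i ((period i)%:R * (l 0 i)%:~R).

Definition window (x : 'rV[R]_n) : R := \prod_i bump (x 0 i / (period i)%:R).

Lemma period_gt0 i : 0 < (period i)%:R :> R.
Proof. by rewrite ltr0n /period; case: ifP. Qed.

Lemma lattice_ptB (l m : 'rV[int]_n) : lattice_pt (l - m) = lattice_pt l - lattice_pt m.
Proof. by apply/rowP => i; rewrite !mxE intrB mulrBr. Qed.

Lemma window_neq0P (x : 'rV[R]_n) :
  reflect (forall i, `|x 0 i| < 2 / 3 * (period i)%:R) (window x != 0).
Proof.
have scale i : (`|x 0 i / (period i)%:R| < 2 / 3) = (`|x 0 i| < 2 / 3 * (period i)%:R).
  by rewrite normrM normfV (gtr0_norm (period_gt0 i)) ltr_pdivrMr ?period_gt0.
apply: (iffP idP) => [/prodf_neq0 h i|h].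
  by rewrite -scale -bump_neq0 h.
by apply/prodf_neq0 => i _; rewrite bump_neq0 scale.
Qed.

Lemma window_eq1 (x : 'rV[R]_n) :
  (forall i, `|x 0 i| <= 1 / 3 * (period i)%:R) -> window x = 1.
Proof.
move=> h; rewrite /window big1 // => i _; apply: bump_eq1.
by rewrite normrM normfV (gtr0_norm (period_gt0 i)) ler_pdivrMr ?period_gt0 ?h.
Qed.

Lemma continuous_window : continuous window.
Proof.
apply: continuous_big; first exact: mul_continuous.
move=> i _ x.
apply: (@continuous_comp _ _ _ (fun x : 'rV[R]_n => x 0 i)
  (fun t => bump (t / (period i)%:R))); first exact: coord_continuous.
apply: (@continuous_comp _ _ _ (fun t : R => t / (period i)%:R));
  last exact: continuous_bump.
exact: mulrr_continuous.
Qed.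

Lemma window_Cc (h : 'rV[R]_n -> Cplx R) : continuous h ->
  Cc (fun x => (window x)%:C%C * h x).
Proof.
move=> hc; split.
  have wc : continuous (fun x => (window x)%:C%C : Cplx R).
    move=> x; apply: (@continuous_comp _ _ _ window (fun x => x%:C%C : Cplx R)).
      exact: continuous_window.
    exact: continuous_real_complex.
  by move=> x; exact: (continuousM (wc x) (hc x)).
(* A compact box containing the support; being closed, it also contains the closure of the
   support. *)
pose box : set 'rV[R]_n := [set v | forall i,
  `[- ((2 / 3) * (period i)%:R), (2 / 3) * (period i)%:R]%classic (v 0 i)].
have box_compact : compact box.
  apply: (@rV_compact R n (fun i =>
    `[- ((2 / 3) * (period i)%:R), (2 / 3) * (period i)%:R]%classic)) => i.
  exact: segment_compact.
apply: (subclosed_compact _ box_compact); first exact: closed_closure.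
have box_closed : closed box.
  apply: compact_closed => //; exact: norm_hausdorff.
rewrite (closure_id box).1 //; apply: closureS => x /=.
rewrite mulf_eq0 negb_or => /andP[wx _] i /=.
have /window_neq0P/(_ i) : window x != 0.
  by apply: contraNneq wx => ->.
by rewrite in_itv /= ltr_norml => /andP[/ltW -> /ltW ->].
Qed.

(** The constant sequence is a witness: its differences vanish, and the inner product of the zero
    function with itself is a sum with empty support, indexed by [void]. *)
Lemma Cc_sub_Xi (f : 'rV[R]_n -> Cplx R) : Cc f -> Xi f.
Proof.
move=> fCc; exists (fun=> f); split=> // [eps eps0|x]; last exact: cvg_cst.
exists 0%N => k l _ _.
have -> : f \- f = fun=> 0 by apply/funext => x; rewrite /= subrr.
have -> : @Xi_norm R n (fun=> 0) = 0; last by [].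
rewrite /Xi_norm.
have inner0 (t : 'rV[R]_n) : Xi_inner (fun=> 0) (fun=> 0) t = 0 :> Cplx R.
  rewrite /Xi_inner (@sum_finite_support _ void _ _ _ (fun v => match v with end)).
  - by rewrite big1 // => - [].
  - by move=> [].
  - by move=> p; rewrite mulr0 eqxx.
rewrite [X in sup X](_ : _ = [set 0]); first by rewrite sup1 sqrtr0.
apply/seteqP; split=> [_ [t _ <-]|_ ->] /=; first by rewrite inner0 Normc.normc0.
by exists 0; rewrite ?inner0 ?Normc.normc0.
Qed.

Variables (j last : 'I_n) (a : int).
Hypothesis lastE : last.+1 = n.

Lemma succ_eq_last (i : 'I_n) : (i.+1 == n) = (i == last).
Proof. by rewrite -[X in _ == X]lastE eqSS. Qed.

Lemma tvecE : tvec R n = delta_mx 0 last.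
Proof. by apply/rowP => i; rewrite !mxE eqxx succ_eq_last. Qed.

Lemma period_last : period last = q.
Proof. by rewrite /period lastE eqxx. Qed.

(** The translations in the [s] variables are stripped first, one axis at a time, so that the twist
    of the remaining translation in [t] is evaluated at [x] itself. *)
Lemma X_lattice_pt (f : 'rV[R]_n -> Cplx R) l x : X q j a f ->
  f (x - lattice_pt l) = e ((l 0 last)%:~R * a%:~R * x 0 j) * f x.
Proof.
move=> [_ fs ft].
have fsn (i : 'I_n) (m : nat) (y : 'rV[R]_n) : (i.+1 < n)%N ->
    f (y + m%:R *: delta_mx 0 i) = f y.
  move=> hi; elim: m y => [|m IH] y; first by rewrite scale0r addr0.
  by rewrite -natr1 scalerDl scale1r addrA fs.
have fsz (i : 'I_n) (m : int) (y : 'rV[R]_n) : (i.+1 < n)%N ->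
    f (y + m%:~R *: delta_mx 0 i) = f y.
  move=> hi; case: m => m; first exact: fsn.
  by rewrite NegzE mulrNz scaleNr -[LHS](fsn i m.+1) // subrK.
have fsum (v : 'I_n -> int) (s : seq 'I_n) (y : 'rV[R]_n) :
    f (y + \sum_(i <- s | i != last) (v i)%:~R *: delta_mx 0 i) = f y.
  elim: s y => [|i s IH] y; first by rewrite big_nil addr0.
  rewrite big_cons; case: ifP => // il; rewrite addrA IH fsz //.
  by rewrite ltn_neqAle ltn_ord succ_eq_last il.
have -> : x - lattice_pt l = x - ((l 0 last)%:~R * q%:R) *: tvec R n +
    \sum_(i | i != last) (- ((period i)%:Z * l 0 i))%:~R *: delta_mx 0 i.
  rewrite -addrA; congr (_ + _); rewrite [LHS]row_sum_delta.
  rewrite (bigD1 last) //= tvecE -scaleNr; congr (_ *: _ + _).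
    by rewrite !mxE period_last mulrC.
  apply: eq_bigr => i _; congr (_ *: _).
  by rewrite !mxE rmorphN rmorphM.
by rewrite (fsum (fun i => - ((period i)%:Z * l 0 i))) ft.
Qed.

End Lattice.

(** * Partition of unity, isometric embedding and periodization *)

Section Partition.
Variables (R : realType) (n q : nat).
Hypothesis q_gt0 : (0 < q)%N.
Local Notation period := (period q).
Local Notation window := (window q).
Local Notation lattice_pt := (@lattice_pt R n q).

(** The 2^n corners, in lattice coordinates, of the cell of Gamma containing [y]; by [window_cell]
    they index all translates of the window that are nonzero at [y]. *)
Definition cell (y : 'rV[R]_n) (b : {ffun 'I_n -> bool}) : 'rV[int]_n :=
  \row_i (Num.floor (y 0 i / (period i)%:R) + (b i : nat)%:Z).

Lemma lattice_pt_scaled y l i :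
  (y - lattice_pt l) 0 i / (period i)%:R = y 0 i / (period i)%:R - (l 0 i)%:~R.
Proof. by rewrite !mxE; field; rewrite gt_eqF ?period_gt0. Qed.

(** By distributivity, the sum over corners of products over axes is a product over axes of two-term
    sums, each equal to 1 by [bump_partition] at a fractional part. *)
Lemma window_partition y : \sum_b window (y - lattice_pt (cell y b)) ^+ 2 = 1.
Proof.
pose u i := y 0 i / (period i)%:R.
pose B i (c : bool) := bump (u i - (Num.floor (u i))%:~R - (c : nat)%:R) ^+ 2.
transitivity (\sum_(b : {ffun 'I_n -> bool}) \prod_i B i (b i)).
  apply: eq_bigr => b _; rewrite /window -prodrXl; apply: eq_bigr => i _.
  by rewrite lattice_pt_scaled mxE intrD opprD addrA.
rewrite -bigA_distr_bigA big1 // => i _.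
rewrite big_bool /= /B addrC subr0.
have /andP[f1 f2] := floor_itv (u i); rewrite intrD in f2.
by apply: bump_partition; apply/andP; split; lra.
Qed.

Lemma window_cell y l : window (y - lattice_pt l) != 0 -> exists b, l = cell y b.
Proof.
move=> /prodf_neq0 h.
exists [ffun i => l 0 i != Num.floor (y 0 i / (period i)%:R)].
apply/rowP => i; rewrite mxE ffunE.
have := h i isT; rewrite lattice_pt_scaled => /bump_sub_int_neq0[b ->].
case: b; last by rewrite addr0 eqxx addr0.
set m := Num.floor _; have -> // : m + 1%N != m by lia.
Qed.

Lemma window_cell_ex y : exists l, window (y - lattice_pt l) != 0.
Proof.
apply: contrapT => /forallNP h.
have := window_partition y; rewrite big1; first by move/esym/eqP; rewrite oner_eq0.
move=> b _; apply/eqP; rewrite sqrf_eq0.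
by apply/negPn/negP; exact: h.
Qed.

Variables (j last : 'I_n) (a : int).
Hypotheses (j_lt : (j.+1 < n)%N) (lastE : last.+1 = n).
Local Notation X := (@X R n q j a).
Local Notation C := (Cplx R).

Definition embed (h : 'rV[R]_n -> C) (x : 'rV[R]_n) : C := (window x)%:C%C * h x.

(** Every point has a Gamma-translate where the window is nonzero. Equality holds there and returns
    to the point because both functions carry the same nonzero twist. *)
Lemma embed_inj : set_inj X embed.
Proof.
move=> f g; rewrite !inE => Xf Xg fg; apply/funext => x.
have [l wl] := window_cell_ex x.
have := congr1 (fun F => F (x - lattice_pt l)) fg; rewrite /embed.
have wlC : ((window (x - lattice_pt l))%:C%C : C) != 0 by rewrite fmorph_eq0.
move=> /(mulfI wlC).
rewrite (X_lattice_pt lastE _ _ Xf) (X_lattice_pt lastE _ _ Xg) => /mulfI; apply.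
apply/eqP => e0; have := e_conj_mul ((l 0 last)%:~R * a%:~R * x 0 j).
by rewrite e0 mulr0 => /eqP; rewrite eq_sym oner_eq0.
Qed.

(** Z^n is the disjoint union of the [q] shifts of Gamma along [t]. The shifts give the sum in
    [X_inner], and within each of them the squared windows sum to 1. *)
Lemma Xi_inner_embed h1 h2 : X h1 -> X h2 ->
  Xi_inner (embed h1) (embed h2) = X_inner q h1 h2.
Proof.
move=> X1 X2; apply/funext => x.
pose y (k : nat) := x - k%:R *: tvec R n.
pose pt (c : 'I_q * {ffun 'I_n -> bool}) : 'rV[int]_n :=
  \row_i ((c.1 * (i == last))%N%:Z + (period i)%:Z * cell (y c.1) c.2 0 i).
have ptE c : x - map_mx intr (pt c) = y c.1 - lattice_pt (cell (y c.1) c.2).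
  apply/rowP => i; rewrite !mxE (succ_eq_last lastE) [in LHS]rmorphD rmorphM /=.
  by rewrite opprD addrA -natrM.
have pt_inj : injective pt.
  move=> [k b] [k' b'] /rowP pteq.
  have kk : k = k'.
    (* The last coordinate modulo [q] recovers the shift [k]. *)
    have := pteq last; rewrite !mxE eqxx !muln1 (period_last q lastE) /=.
    move/(congr1 (fun m => (m %% q)%Z)).
    rewrite ![_ + q%:Z * _]addrC ![q%:Z * _]mulrC !modzMDl !modz_nat.
    by rewrite !modn_small // => -[] /val_inj.
  subst k'; congr (_, _); apply/ffunP => i.
  have := pteq i; rewrite !mxE => /addrI/mulfI.
  have p0 : (period i)%:Z != 0 by rewrite -(intr_eq0 R) gt_eqF ?period_gt0.
  move=> /(_ p0)/addrI; by case: (b i) (b' i) => - [].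
rewrite /Xi_inner (sum_finite_support pt_inj); last first.
  move=> p; rewrite /embed mulf_eq0 negb_or => /andP[_].
  rewrite mulf_eq0 negb_or => /andP[wp _].
  have {}wp : window (x - map_mx intr p) != 0 by apply: contraNneq wp => ->.
  have qz : q%:Z != 0 by rewrite -lt0n.
  have kq : (`|(p 0%R last %% q)%Z| < q)%N.
    rewrite -ltz_nat gez0_abs ?modz_ge0 // ltz_mod //.
  pose k : 'I_q := Ordinal kq.
  have kE : (k : nat)%:Z = (p 0%R last %% q)%Z by rewrite /= gez0_abs ?modz_ge0.
  (* Euclidean division of the last coordinate by [q] splits [p] into a shift [k] along [t] and a
     point of Gamma. *)
  pose l : 'rV[int]_n := \row_i (if i == last then (p 0%R last %/ q)%Z else p 0 i).
  have pE : x - map_mx intr p = y k - lattice_pt l.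
    apply/rowP => i; rewrite !mxE (succ_eq_last lastE).
    have [->|il] := eqVneq i last.
      rewrite (period_last q lastE) {1}(divz_eq (p 0 last) q) rmorphD rmorphM /=.
      rewrite ?eqxx mulr1 opprD addrA addrAC; congr (_ - _ - _); last by rewrite mulrC.
      by rewrite -kE.
    by rewrite ?(negbTE il) /= mulr0 subr0 /period (succ_eq_last lastE)
      (negbTE il) mul1r.
  have [b lE] : exists b, l = cell (y k) b by apply: window_cell; rewrite -pE.
  exists (k, b); apply/rowP => i.
  have := congr1 (fun v : 'rV[R]_n => v 0 i) (ptE (k, b)).
  rewrite /= -lE -pE !mxE => /addrI/oppr_inj/intr_inj.
  by move<-.
rewrite -(pair_bigA _ (fun k b => (embed h1 (x - map_mx intr (pt (k, b))))^* *
  embed h2 (x - map_mx intr (pt (k, b))))) /X_inner /=.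
apply: eq_bigr => k _.
(* At a given lattice point [h1] and [h2] acquire the same twist, of modulus 1, which cancels
   against its conjugate. *)
transitivity (\sum_b (window (y k - lattice_pt (cell (y k) b)) ^+ 2)%:C%C *
   ((h1 (y k))^* * h2 (y k))).
  apply: eq_bigr => b _; rewrite ptE /= /embed.
  rewrite (X_lattice_pt lastE _ _ X1) (X_lattice_pt lastE _ _ X2).
  set E := e _; set w := window _.
  have wconj : (w%:C%C : C)^* = w%:C%C by apply/eqP; rewrite eq_complex /= oppr0 !eqxx.
  have -> : (w ^+ 2)%:C%C = w%:C%C * w%:C%C :> C by rewrite expr2 rmorphM.
  rewrite !(rmorphM Num.conj) /= wconj.
  rewrite -[RHS]mulr1 -(e_conj_mul ((cell (y k) b 0 last)%:~R * a%:~R * (y k) 0 j)) -/E.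
  ring.
by rewrite -mulr_suml -rmorph_sum window_partition mul1r.
Qed.

(** At each point at most one term [G l] of the twisted periodization is nonzero, and only the
    nearest lattice point can supply it. Hence [g] is defined by that term, without any infinite
    sum. *)
Lemma periodization (F : 'rV[R]_n -> C) : continuous F ->
  (forall z, F z != 0 -> forall i, `|z 0 i| <= 1 / 3 * (period i)%:R) ->
  exists2 g, X g & forall z, window z != 0 -> g z = F z.
Proof.
move=> Fc Fsupp.
pose rv (y : 'rV[R]_n) : 'rV[int]_n := \row_i nearest (y 0 i / (period i)%:R).
pose tw (l : 'rV[int]_n) (y : 'rV[R]_n) : C := e (- ((l 0 last)%:~R * a%:~R * y 0 j)).
pose G l y := tw l y * F (y - lattice_pt l).
pose g y := G (rv y) y.
have scale y m i : `|(y - lattice_pt m) 0 i| =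
    `|y 0 i / (period i)%:R - (m 0 i)%:~R| * (period i)%:R.
  have p0 := period_gt0 R q_gt0 i.
  by rewrite -lattice_pt_scaled normrM normfV (gtr0_norm p0) divfK // lt0r_neq0.
(* [F] lives within [c_i / 3] of 0, while two lattice points differ by at least
   [c_i] along some axis: within [2 c_i / 3] of [l] no other point contributes. *)
have gE l y : window (y - lattice_pt l) != 0 -> g y = G l y.
  move=> /window_neq0P wl.
  have [<-//|/eqP/rowP/existsNP[i /eqP neq]] := eqVneq (rv y) l.
  have p0 := period_gt0 R q_gt0 i.
  have far : 1 / 2 <= `|y 0 i / (period i)%:R - (l 0 i)%:~R|.
    by apply: nearest_neq_dist; rewrite eq_sym; move: neq; rewrite mxE.
  have near2 : `|y 0 i / (period i)%:R - (l 0 i)%:~R| < 2 / 3.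
    by have := wl q_gt0 i; rewrite scale ltr_pM2r.
  have sep : 1 <= `|(l 0 i)%:~R - (rv y 0 i)%:~R : R|.
    rewrite -intrB -intr_norm -[1]/(1%:~R) ler_int.
    by have : l 0 i - rv y 0 i != 0; [rewrite subr_eq0 eq_sym|lia].
  have G0 m : `|(y - lattice_pt m) 0 i| > 1 / 3 * (period i)%:R -> G m y = 0.
    move=> h; apply/eqP; rewrite mulf_eq0; apply/orP; right.
    by apply: contraLR h => /Fsupp/(_ i); rewrite leNgt.
  rewrite /g !G0 // scale ltr_pM2r //; first lra.
  move: sep near2; have := ler_distD (y 0 i / (period i)%:R) (l 0 i)%:~R (rv y 0 i)%:~R.
  rewrite [ `|(l 0 i)%:~R - _ / _|]distrC; lra.
have gC : continuous g.
  move=> y0.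
  have sC l : continuous (fun y : 'rV[R]_n => y - lattice_pt l).
    move=> y; have idC : {for y, continuous (@idfun 'rV[R]_n)} by exact: cvg_id.
    have cstC : {for y, continuous (fun _ : 'rV[R]_n => lattice_pt l)}
      by apply: cst_continuous.
    exact: (continuousB idC cstC).
  have GC l : continuous (G l).
    have twC : continuous (tw l).
      move=> y; apply: (@continuous_comp _ _ _ (fun y : 'rV[R]_n => y 0 j)
        (fun t => e (- ((l 0 last)%:~R * a%:~R * t)))); first exact: coord_continuous.
      apply: (@continuous_comp _ _ _ (fun t : R => - ((l 0 last)%:~R * a%:~R * t))
        (@e R)).
        by apply: cvgN; exact: mulrl_continuous.
      exact: continuous_e.
    have FC : continuous (fun y : 'rV[R]_n => F (y - lattice_pt l)).
      by move=> y; apply: continuous_comp; [exact: sC|exact: Fc].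
    by move=> y; exact: (continuousM (twC y) (FC y)).
  (* The index [rv] jumps, but since 1/2 < 2/3 the window around [rv y0] stays nonzero near [y0],
     where [gE] identifies [g] with the single continuous function [G (rv y0)]. *)
  have w0 : window (y0 - lattice_pt (rv y0)) != 0.
    apply/window_neq0P => // i; rewrite scale ltr_pM2r ?period_gt0 //.
    have := nearest_dist (y0 0 i / (period i)%:R); rewrite !mxE; lra.
  have nearE : \forall y \near y0, G (rv y0) y = g y.
    have wC : {for y0, continuous
        (fun y : 'rV[R]_n => window (y - lattice_pt (rv y0)))}.
      by apply: continuous_comp; [exact: sC|exact: continuous_window].
    near=> y; rewrite (gE (rv y0)) //.
    by near: y; exact: (cvgr_neq0 _ wC w0).
  rewrite /continuous_at (gE _ _ w0).
  apply: cvg_trans (GC (rv y0) y0).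
  exact: (near_eq_cvg nearE).
have gT l y : g (y - lattice_pt l) = e ((l 0 last)%:~R * a%:~R * y 0 j) * g y.
  have rvE : rv (y - lattice_pt l) = rv y - l.
    by apply/rowP => i; rewrite mxE lattice_pt_scaled -rmorphN nearestD !mxE.
  rewrite /g rvE /G lattice_ptB opprB addrA subrK mulrA; congr (_ * _).
  have pj : period j = 1%N by rewrite /period ltn_eqF.
  rewrite /tw -eD !mxE pj mul1r.
  rewrite -[RHS]mulr1.
  (* Translating by [l] also moves the coordinate [j] inside the twist; the resulting cross term is
     [e] of an integer, hence 1. *)
  rewrite -(e_int R ((nearest (y 0 last / (period last)%:R) - l 0 last) * a * l 0 j)) -eD.
  by congr e; rewrite !rmorphM /= !rmorphB /=; ring.
have e0 : e 0 = 1 :> C by rewrite -[0]/(0%:~R) e_int.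
(* Both translation conditions of [X] are instances of [gT], at minus a basis vector for [s] and at
   a multiple of the last one for [t]. *)
exists g; first split=> //.
- move=> i y il.
  have -> : y + delta_mx 0 i = y - lattice_pt (- delta_mx 0 i).
    congr (_ + _); apply/rowP => i'; rewrite !mxE eqxx /= rmorphN mulrN opprK.
    by case: eqVneq => [->|]; rewrite ?mulr0 // /period ltn_eqF // mulr1.
  rewrite gT !mxE eqxx /= (_ : (last == i) = false) ?oppr0 ?mul0r ?e0 ?mul1r //.
  by apply: contraTF il => /eqP <-; rewrite lastE ltnn.
- move=> k y.
  have -> : (k%:~R * q%:R) *: tvec R n = lattice_pt (k *: delta_mx 0 last).
    apply/rowP => i; rewrite (tvecE _ lastE) !mxE eqxx /=.
    case: eqVneq => [->|]; rewrite ?mulr0 //.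
    by rewrite (period_last q lastE) !mulr1 mulrC.
  by rewrite gT !mxE !eqxx mulr1.
move=> z wz; have lat0 : lattice_pt 0 = 0.
  by apply/rowP => i; rewrite !mxE mulr0.
have := gE 0 z; rewrite lat0 subr0 => /(_ wz) ->.
by rewrite /G lat0 subr0 /tw mxE !mul0r oppr0 e0 mul1r.
Unshelve. all: by end_near. Qed.

End Partition.

(** * Linear changes of variable and invariance under the dilation *)

Lemma continuous_mulmxr (R : realType) (m n : nat) (A : 'M[R]_(m, n)) :
  continuous (fun y : 'rV[R]_m => y *m A).
Proof.
have -> : (fun y : 'rV[R]_m => y *m A) = (fun y => \sum_i y 0 i *: row i A).
  by apply/funext => y; rewrite mulmx_sum_row.
apply: continuous_big; first exact: add_continuous.
move=> i _ y; apply: (@continuous_comp _ _ _ (fun y : 'rV[R]_m => y 0 i)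
  (fun t : R => t *: row i A)).
  exact: coord_continuous.
exact: scalel_continuous.
Qed.

Theorem theorem3p2 (R : realType) (n : nat) (hn : (2 <= n)%N)
    (d : 'I_n -> int) (hd : forall i, 1 < `|d i|)
    (A : 'M[R]_n) (hA : A = diag_mx (\row_i (d i)%:~R))
    (q : nat) (hq : (0 < q)%N)
    (j : 'I_n) (hj : (j.+1 < n)%N) (a : int) :
  exists Phi : ('rV[R]_n -> Cplx R) -> ('rV[R]_n -> Cplx R),
    [/\ CT_monomorphism (X q j a) (@Xi R n) Phi,
        forall h1 h2, X q j a h1 -> X q j a h2 ->
          Xi_inner (Phi h1) (Phi h2) = X_inner q h1 h2 &
        Phi @` X q j a `<=` dilation_hat A @` (Phi @` X q j a)].
Proof.
have [last lastE] : exists last : 'I_n, last.+1 = n.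
  have n1 : (n.-1 < n)%N by rewrite prednK // ltnW.
  by exists (Ordinal n1); rewrite /= prednK // ltnW.
exists (embed q); split.
- split.
  + by move=> f [fC _ _]; exact/Cc_sub_Xi/window_Cc.
  + by move=> f g _ _; apply/funext => x; rewrite /embed /= mulrDr.
  + by move=> f c _ _; apply/funext => x; rewrite /embed /= mulrA.
  + exact: (embed_inj hq lastE).
- by move=> h1 h2; exact: (Xi_inner_embed hq lastE).
move=> _ [h Xh <-].
have hC : continuous h by case: Xh.
have detN0 : \det A != 0.
  rewrite hA det_diag; apply/prodf_neq0 => i _; rewrite mxE intr_eq0.
  by have := hd i; case: (eqVneq (d i) 0) => // ->; rewrite normr0.
have rN0 : Num.sqrt `|\det A| != 0 by rewrite sqrtr_eq0 -ltNge normr_gt0.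
have Aunit : A \in unitmx by rewrite unitmxE unitfE.
(* [F] is the preimage of [embed q h] under [dilation_hat A]; it remains to write it as
   [embed q g]. *)
pose F (y : 'rV[R]_n) : Cplx R := (Num.sqrt `|\det A|)%:C%C * embed q h (y *m A).
have FC : continuous F.
  have [eC _] := window_Cc hq hC.
  have eA : continuous (fun y : 'rV[R]_n => embed q h (y *m A)).
    by move=> y; apply: continuous_comp; [exact: continuous_mulmxr|exact: eC].
  have cC : continuous (fun _ : 'rV[R]_n => (Num.sqrt `|\det A|)%:C%C : Cplx R).
    exact: cst_continuous.
  by move=> y; exact: (continuousM (cC y) (eA y)).
have Fsupp z : F z != 0 -> forall i, `|z 0 i| <= 1 / 3 * (period q i)%:R.
  rewrite /F /embed !mulf_eq0 !negb_or => /andP[_ /andP[wz _]] i.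
  have /(window_neq0P hq)/(_ i) : window q (z *m A) != 0 by apply: contraNneq wz => ->.
  rewrite hA mul_mx_diag !mxE normrM => zd.
  (* Integrality turns [1 < |d i|] into a factor of at least 2, just enough to shrink the support
     radius from 2/3 to 1/3 of the period. *)
  have d2 : 2 <= `|(d i)%:~R : R| by rewrite -intr_norm -[2]/(2%:~R) ler_int; exact: hd.
  have := ler_wpM2l (normr_ge0 (z 0 i)) d2; lra.
have [g Xg gF] := periodization hq a hj lastE FC Fsupp.
exists (embed q g); first by exists g.
apply/funext => x; rewrite /dilation_hat.
set y := x *m invmx A.
have embedF : embed q g y = F y.
  (* If [F y] is 0, either the window vanishes at [y] or [g y = F y = 0]; otherwise the window
     equals 1 there and [g y = F y]. *)
  rewrite /embed; have [Fy|Fy] := eqVneq (F y) 0.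
    by have [->|wy] := eqVneq (window q y) 0; rewrite ?mul0r ?gF ?Fy ?mulr0.
  have wy := window_eq1 hq (Fsupp _ Fy).
  by rewrite gF ?wy ?oner_eq0 // mul1r.
rewrite embedF /F mulrA mulmxKV // -rmorphM mulVf // mul1r //.
Qed.
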